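(* Let $(R,\mathfrak m,K)$ be a one-dimensional Buchsbaum local ring, and let $M$ be a finitely generated $R$-module with $\lambda(M)<\infty$ and $\operatorname{pd}_R(M)=\infty$. Then for every $i>2$ the $i$-th syzygy $\Omega_i(M)$ has infinite length.
   Context: Rings are commutative and Noetherian; $\lambda$ denotes length. A local ring $(R,\mathfrak m,K)$ of dimension $d$ is Buchsbaum if for every system of parameters $x_1,\dots,x_d$ of $R$ one has $(x_1,\dots,x_{i-1}):x_i=(x_1,\dots,x_{i-1}):\mathfrak m$ for every $i=1,\dots,d$ (for $i=1$ the ideal $(x_1,\dots,x_{i-1})$ is the zero ideal). For a minimal free resolution $\cdots\to G_1\xrightarrow{\varphi_1}G_0\to M\to 0$ (finitely generated free modules, $\operatorname{Im}(\varphi_{j+1})\subseteq\mathfrak mG_j$), set $\Omega_0(M)=M$ and $\Omega_i(M)=\operatorname{Im}(\varphi_i)\subseteq G_{i-1}$ for $i\ge1$. *)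

(* Defs.v *)
From HB Require Import structures.
From mathcomp Require Import all_boot all_order all_algebra.
From mathcomp Require Import ring_quotient.
From mathcomp Require Import boolp classical_sets.

Set Implicit Arguments.
Unset Strict Implicit.
Unset Printing Implicit Defensive.

Import GRing.Theory.
Local Open Scope classical_set_scope.
Local Open Scope ring_scope.

(* Submodules and ideals are classical sets; [mem N] turns a set into the
   collective predicate expected by the closure conditions of ssralg. *)
Section Submodules.
Variable R : comNzRingType.

Definition submodule (V : lmodType R) (N : set V) : Prop :=
  GRing.submod_closed (mem N).

Definition submod_span (V : lmodType R) (S : set V) : set V :=
  smallest (@submodule V) S.

Definition finitely_generated (V : lmodType R) (N : set V) : Prop :=
  exists s : seq V, N = submod_span [set` s].

Definition ideal (I : set R) : Prop := @submodule R^o I.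

Definition ideal_gen (S : set R) : set R := @submod_span R^o S.

Definition ideal_smul (I : set R) (V : lmodType R) : set V :=
  submod_span [set v | exists2 a, I a & exists g : V, v = a *: g].

Definition colon (I J : set R) : set R :=
  [set a | forall b, J b -> I (a * b)].

Definition radical (I : set R) : set R := [set a | exists n, I (a ^+ n)].

(* [idealr_closed] already requires the ideal to be proper. *)
Definition prime_ideal (P : set R) : Prop :=
  idealr_closed (mem P) /\ prime_idealr_closed (mem P).

Definition maximal_ideal (m : set R) : Prop :=
  idealr_closed (mem m) /\
  forall J : set R, idealr_closed (mem J) -> m `<=` J -> J = m.

Definition local_ring (m : set R) : Prop :=
  maximal_ideal m /\ forall n : set R, maximal_ideal n -> n = m.

End Submodules.

Arguments ideal_smul {R} I V.

Definition noetherian (R : comNzRingType) : Prop :=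
  forall I : set R, ideal I -> @finitely_generated R R^o I.

(* [c 0 < c 1 < ... < c n], strict inclusions between n + 1 members of C; the
   values of c beyond n are irrelevant. *)
Definition strict_chain (T : Type) (C : set (set T)) (n : nat)
    (c : nat -> set T) : Prop :=
  (forall i, (i <= n)%N -> C (c i)) /\
  (forall i, (i < n)%N -> c i `<` c i.+1).

(* A chain of length n.+1 truncates to one of length n, so this says that n is
   the supremum of the lengths of the strict chains in C. *)
Definition max_chain_length (T : Type) (C : set (set T)) (n : nat) : Prop :=
  (exists c, strict_chain C n c) /\ ~ (exists c, strict_chain C n.+1 c).

Definition krull_dim (R : comNzRingType) (d : nat) : Prop :=
  max_chain_length (@prime_ideal R) d.

Definition has_length (R : comNzRingType) (V : lmodType R) (N : set V)
    (l : nat) : Prop :=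
  max_chain_length [set L : set V | submodule L /\ L `<=` N] l.

Definition finite_length (R : comNzRingType) (V : lmodType R) (N : set V) :
    Prop :=
  exists l, has_length N l.

Definition system_of_parameters (R : comNzRingType) (m : set R) (d : nat)
    (x : 'I_d -> R) : Prop :=
  krull_dim R d /\ radical (ideal_gen (range x)) = m.

Definition buchsbaum (R : comNzRingType) (m : set R) : Prop :=
  forall (d : nat) (x : 'I_d -> R), system_of_parameters m x ->
  forall i : 'I_d,
    let I := ideal_gen [set x j | j in [set j : 'I_d | (j < i)%N]] in
    colon I [set x i] = colon I m.

(* [diff F j : term F j.+1 -> term F j] is the map phi_{j+1}. *)
Record resolution (R : comNzRingType) (M : lmodType R) := Resolution {
  term : nat -> lmodType R;
  diff : forall j, {linear term j.+1 -> term j};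
  aug : {linear term 0 -> M};
  aug_surj : range aug = setT;
  aug_exact : range (diff 0) = [set x | aug x = 0];
  diff_exact : forall j, range (diff j.+1) = [set x | diff j x = 0]
}.

Definition fg_free (R : comNzRingType) (V : lmodType R) : Prop :=
  exists n (e : 'I_n -> V),
    forall v, exists! c : 'rV[R]_n, v = \sum_i c ord0 i *: e i.

Definition minimal_free_resolution (R : comNzRingType) (m : set R)
    (M : lmodType R) (G : resolution M) : Prop :=
  (forall j, fg_free (term G j)) /\
  (forall j, range (diff G j) `<=` ideal_smul m (term G j)).

Definition projective (R : comNzRingType) (P : lmodType R) : Prop :=
  forall (A B : lmodType R) (f : {linear A -> B}) (g : {linear P -> B}),
    range f = setT -> exists h : {linear P -> A}, forall x, f (h x) = g x.

Definition projdim_le (R : comNzRingType) (M : lmodType R) (n : nat) : Prop :=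
  exists P : resolution M,
    (forall j, projective (term P j)) /\
    (forall j, (n < j)%N -> forall x : term P j, x = 0).

Definition infinite_projdim (R : comNzRingType) (M : lmodType R) : Prop :=
  ~ exists n, projdim_le M n.

Definition syzygy_ambient (R : comNzRingType) (M : lmodType R)
    (G : resolution M) (i : nat) : lmodType R :=
  if i is j.+1 then term G j else M.

Definition syzygy (R : comNzRingType) (M : lmodType R) (G : resolution M)
    (i : nat) : set (syzygy_ambient G i) :=
  match i return set (syzygy_ambient G i) with
  | 0 => setT
  | j.+1 => range (diff G j)
  end.

Arguments syzygy {R M} G i.

(* Main.v *)
Require Import Defs.
From HB Require Import structures.
From mathcomp Require Import all_boot all_order all_algebra.
From mathcomp Require Import ring_quotient boolp.
From mathcomp Require Import classical_sets.

(* Let x be a parameter and U = 0 : m.  Powers of x are parameters too, so the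
   Buchsbaum condition gives 0 : x^n = U for every n > 0.  If Omega_(k+3) =
   ker (diff k.+1) has finite length, each of its elements is killed by a power
   of x and hence has coordinates in U.  If U = 0 or term k.+1 = 0, then
   diff k.+1 or diff k is injective and the truncated resolution shows that M
   has finite projective dimension.  Otherwise take 0 <> u in U and a basis
   element e: by minimality u e is in ker (diff k) = Im (diff k.+1), say
   u e = diff k.+1 w.  Then x w lies in Omega_(k+3), so a power of x kills w,
   the coordinates of w are in U, and diff k.+1 w = 0 by minimality, so
   u = 0.

   A parameter exists by prime avoidance: 0 contains a product of finitely many
   primes, among which are all the non-maximal primes of R, and the latter are
   pairwise incomparable because dim R = 1. *)

Set Implicit Arguments.
Unset Strict Implicit.
Unset Printing Implicit Defensive.

Import GRing.Theory.
Local Open Scope classical_set_scope.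
Local Open Scope ring_scope.

Section Submodules.
Variable R : comNzRingType.
Implicit Types (V : lmodType R) (I J p m : set R).

(** * Submodules and ideals as closed sets *)

Lemma submoduleP V (N : set V) :
  submodule N <-> N 0 /\ forall a u v, N u -> N v -> N (a *: u + v).
Proof.
split=> [[N0 NL]|[N0 NL]].
  split=> [|a u v Nu Nv]; first by rewrite -in_setE.
  by rewrite -in_setE; apply: NL; rewrite in_setE.
split; first by rewrite in_setE.
by move=> a u v; rewrite !in_setE; apply: NL.
Qed.

Lemma submoduleZ V (N : set V) a v : submodule N -> N v -> N (a *: v).
Proof.
by move=> /submoduleP [N0 NL] Nv; rewrite -[_ *: _]addr0; apply: NL.
Qed.

Lemma submodule_cyclic V (v : V) : submodule [set a *: v | a in setT].
Proof.
apply/submoduleP; split; first by exists 0; rewrite ?scale0r.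
move=> a _ _ [b _ <-] [c _ <-]; exists (a * b + c) => //.
by rewrite scalerDl scalerA.
Qed.

Lemma submodule_span V (S : set V) : submodule (submod_span S).
Proof.
apply/submoduleP; split=> [N [/submoduleP[]]|a u v Su Sv N SN] //.
have [/submoduleP [_ NL] _] := SN.
by apply: NL; [apply: Su|apply: Sv].
Qed.

Lemma idealP I :
  ideal I <-> I 0 /\ forall a b c, I b -> I c -> I (a * b + c).
Proof. exact: submoduleP. Qed.

Lemma idealMl I a b : ideal I -> I b -> I (a * b).
Proof. exact: submoduleZ. Qed.

Lemma idealMr I a b : ideal I -> I a -> I (a * b).
Proof. by move=> Iid Ia; rewrite mulrC; apply: idealMl. Qed.

Lemma idealD I a b : ideal I -> I a -> I b -> I (a + b).
Proof. by move=> /idealP [_ IL] Ia Ib; rewrite -[a]mul1r; apply: IL. Qed.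

Lemma idealB I a b : ideal I -> I a -> I b -> I (a - b).
Proof.
by move=> HI Ia Ib; rewrite -mulN1r; apply: idealD => //; apply: idealMl.
Qed.

Lemma proper_idealP I : idealr_closed (mem I) <-> ideal I /\ ~ I 1.
Proof.
split=> [[I0 I1 IL]|[[I0 IL] I1]].
  by split=> // I1'; case/negP: I1; rewrite in_setE.
by split=> //; apply/negP; rewrite in_setE; exact: I1.
Qed.

Lemma prime_idealP p :
  prime_ideal p <->
  [/\ ideal p, ~ p 1 & forall a b, p (a * b) -> p a \/ p b].
Proof.
split=> [[/proper_idealP [pI p1] pP]|[pI p1 pP]].
  split=> // a b pab; have /orP := pP a b (mem_set pab).
  by rewrite !in_setE.
split; first by apply/proper_idealP.
by move=> a b; rewrite !in_setE => /pP pab; apply/orP; rewrite !in_setE.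
Qed.

Lemma prime_idealX p a n : prime_ideal p -> p (a ^+ n) -> p a.
Proof.
move=> /prime_idealP [_ p1 pP]; elim: n => [|n IHn]; first by rewrite expr0.
by rewrite exprS => /pP [].
Qed.

Lemma ideal_adjoin I a :
  ideal I -> ideal [set b + c * a | b in I & c in setT].
Proof.
move=> IH; have /idealP [I0 IL] := IH; apply/idealP; split.
  by exists 0 => //; exists 0; rewrite // mul0r addr0.
move=> d _ _ [b Ib [c _ <-]] [b' Ib' [c' _ <-]].
exists (d * b + b'); first exact: IL.
by exists (d * c + c') => //; rewrite mulrDr mulrDl addrACA mulrA.
Qed.

Lemma adjoin_proper I a : ideal I -> ~ I a ->
  I `<` [set b + c * a | b in I & c in setT].
Proof.
move=> IH Ia; have /submoduleP [I0 _] := IH; split=> [b Ib|].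
  by exists b => //; exists 0; rewrite // mul0r addr0.
move=> aI; apply/Ia/aI.
by exists 0 => //; exists 1; rewrite // mul1r add0r.
Qed.

(** * Noetherian induction, products of primes, prime avoidance *)

Lemma noetherian_ind (P : set R -> Prop) : noetherian R ->
  (forall I, ideal I -> (forall J, ideal J -> I `<` J -> P J) -> P I) ->
  forall I, ideal I -> P I.
Proof.
move=> noeR IHP I0 I0id; apply: contrapT => nPI0.
(* If [P I0] failed, dependent choice would give a strictly increasing chain [f] of ideals; the
   finitely many generators of its union lie in one [f N]. *)
pose T := {I : set R | ideal I /\ ~ P I}.
have step (I : T) : {J : T | sval I `<` sval J}.
  case: I => I [Iid nPI]; apply: cid; apply: contrapT => noJ.
  apply/nPI/IHP => // J Jid ltIJ; apply: contrapT => nPJ.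
  by apply: noJ; exists (exist _ J (conj Jid nPJ)).
have [f [_ fS]] := dependent_choice step (exist _ I0 (conj I0id nPI0)).
have f_mono i j : (i <= j)%N -> sval (f i) `<=` sval (f j).
  elim: j => [|j IHj]; first by rewrite leqn0 => /eqP->.
  rewrite leq_eqVlt => /predU1P [->//|ltij].
  by apply: subset_trans (IHj ltij) _; case: (fS j).
pose U := \bigcup_i sval (f i).
have fid i : ideal (sval (f i)) by case: (svalP (f i)).
have Uid : ideal U.
  apply/submoduleP; split.
    by exists 0%N => //; have /submoduleP [] := fid 0%N.
  move=> a u v [i _ fiu] [j _ fjv]; exists (maxn i j) => //.
  have /submoduleP [_] := fid (maxn i j); apply.
    by apply: f_mono fiu; rewrite leq_maxl.
  by apply: f_mono fjv; rewrite leq_maxr.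
have [s Us] := noeR _ Uid.
have [N sN] : exists N, [set` s] `<=` sval (f N).
  have: [set` s] `<=` U by rewrite Us; apply: sub_gen_smallest.
  elim: (s) => [|a t IHt] tU; first by exists 0%N.
  have [|N tN] := IHt.
    by move=> b tb; apply: tU; rewrite /= inE (_ : b \in t) ?orbT.
  have [i _ fia] := tU a (mem_head _ _).
  exists (maxn i N) => b /=; rewrite inE => /predU1P [->|tb].
    by apply: f_mono fia; rewrite leq_maxl.
  by apply: f_mono (tN b tb); rewrite leq_maxr.
have UN : U `<=` sval (f N).
  by rewrite Us; apply: smallest_sub sN; apply: fid.
have [_ []] := fS N; by apply: subset_trans UN => a fa; exists N.+1.
Qed.

(** Plain products, one factor from each set, stand for the product ideal: both are contained in the
    same ideals. *)
Definition mulset (s : seq (set R)) : set R :=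
  foldr (fun p A => [set a * b | a in p & b in A]) [set 1] s.

Lemma mulset_cat s t : mulset (s ++ t) `<=`
  [set a * b | a in mulset s & b in mulset t].
Proof.
elim: s => [|p s IHs] /=.
  by move=> b tb; exists 1 => //; exists b; rewrite // mul1r.
move=> _ [a pa [_ /IHs [b sb [c tc <-]] <-]]; exists (a * b).
  by exists a => //; exists b.
by exists c; rewrite // mulrA.
Qed.

(** Elements chosen outside [p], one from each set, would have a product outside [p]. *)
Lemma mulset_prime s p : prime_ideal p -> mulset s `<=` p ->
  exists2 q, q \in s & q `<=` p.
Proof.
move=> /prime_idealP [pid p1 pP]; elim: s => [|q s IHs] sp.
  by case: p1; apply: sp.
have [qp|/existsNP [a /not_implyP [qa pa]]] := pselect (q `<=` p).
  by exists q; rewrite ?mem_head.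
have [|r sr rp] := IHs; last by exists r; rewrite // inE sr orbT.
move=> b sb; have [|/pa|] := pP a b => //.
by apply: sp; exists a => //; exists b.
Qed.

(** Used with [Q] the complement of a prime and with [Q] the powers of one element. *)
Lemma mulset_exists s (Q : set R) : (forall q, q \in s -> q `&` Q !=set0) ->
  (forall a b, Q a -> Q b -> Q (a * b)) -> Q 1 -> mulset s `&` Q !=set0.
Proof.
move=> sQ QM Q1; elim: s sQ => [|p s IHs] sQ; first by exists 1.
have [a [pa Qa]] := sQ p (mem_head _ _).
have [b [sb Qb]] := IHs (fun q sq => sQ q (mem_behead (s := p :: s) sq)).
by exists (a * b); split; [exists a => //; exists b|apply: QM].
Qed.

Lemma mulset_ideal s q a : (forall p, p \in s -> ideal p) ->
  q \in s -> mulset s a -> q a.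
Proof.
elim: s a => [//|p s IHs] a sid; rewrite inE => qs [b pb [c sc <-]].
have {sid} [pid sid] : ideal p /\ forall r, r \in s -> ideal r.
  by split=> [|r rs]; apply: sid; rewrite inE ?eqxx // rs orbT.
by case/predU1P: qs => [->|qs]; [apply: idealMr|apply: idealMl; auto].
Qed.

(** If [a * b] is in [I] but neither factor is, then (I + Ra)(I + Rb) lies in [I], so the lists
    found for the two larger ideals are concatenated. The unit ideal gets the empty list. *)
Lemma noetherian_prime_product I : noetherian R -> ideal I ->
  exists2 s, mulset s `<=` I &
    forall p, p \in s -> prime_ideal p /\ I `<=` p.
Proof.
move=> noeR; move: I; apply: noetherian_ind => // I Iid IHI.
have [I1|I1] := pselect (I 1); first by exists [::] => // _ ->.
have [Ip|Inp] := pselect (prime_ideal I).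
  exists [:: I]; last by move=> p; rewrite inE => /eqP->; split=> // ?.
  by move=> _ [a Ia [_ -> <-]]; rewrite mulr1.
have [a [b [Iab [Ia Ib]]]] : exists a b, I (a * b) /\ ~ I a /\ ~ I b.
  apply: contrapT => noab; apply: Inp; apply/prime_idealP; split=> // a b Iab.
  apply: contrapT => /not_orP [Ia Ib]; apply: noab; exists a, b; tauto.
have [s sI sP] := IHI _ (ideal_adjoin a Iid) (adjoin_proper Iid Ia).
have [t tI tP] := IHI _ (ideal_adjoin b Iid) (adjoin_proper Iid Ib).
exists (s ++ t).
  move=> _ /mulset_cat [_ /sI [c Ic [d _ <-]] [_ /tI [e Ie [f _ <-]] <-]].
  rewrite mulrDl; apply: idealD; [|exact: idealMr|rewrite mulrDr] => //.
  apply: idealD => //; first exact: idealMl.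
  by rewrite mulrACA; apply: idealMl.
move=> p; rewrite mem_cat => /orP [/sP|/tP] [pp Ip]; split=> //.
  by apply: subset_trans Ip; case: (adjoin_proper Iid Ia).
by apply: subset_trans Ip; case: (adjoin_proper Iid Ib).
Qed.

Lemma ideal0 : ideal [set 0 : R].
Proof. by apply/idealP; split=> // a b c -> ->; rewrite mulr0 addr0. Qed.

Lemma ideal_principal (a : R) : ideal [set b * a | b in setT].
Proof. exact: (submodule_cyclic (a : R^o)). Qed.

(** When [x] avoids the tail but lies in [p], it is corrected by [a * b], with [a] in [I] and [b] in
    every prime of the tail, both outside [p]. *)
Lemma prime_avoidance_incomparable I (s : seq (set R)) :
  ideal I -> (forall p, p \in s -> prime_ideal p) ->
  (forall p, p \in s -> ~ I `<=` p) ->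
  (forall p q, p \in s -> q \in s -> q `<=` p -> q = p) ->
  exists2 x, I x & forall p, p \in s -> ~ p x.
Proof.
move=> Iid; elim: s => [|p s IHs] sP sI s_inc.
  by exists 0 => //; have /idealP [] := Iid.
have sS q : q \in s -> q \in p :: s by rewrite inE orbC => ->.
have [|||x Ix xs] := IHs.
- by move=> q /sS; apply: sP.
- by move=> q /sS; apply: sI.
- by move=> q r /sS qs /sS rs; apply: s_inc.
have [px|npx] := pselect (p x); last first.
  by exists x => // q; rewrite inE => /predU1P [->|/xs].
have [pid p1 pP] := (prime_idealP p).1 (sP p (mem_head _ _)).
have [b [sb npb]] : mulset s `&` ~` p !=set0.
  apply: mulset_exists => // [q qs|a b pa pb /pP []//].
  (* No [q] of the tail lies in [p]: it would equal [p] and contain [x]. *)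
  apply: contrapT => qp; apply: (xs q qs).
  rewrite (s_inc p q) ?mem_head ?sS // => c qc.
  by apply: contrapT => npc; apply: qp; exists c.
have /existsNP [a /not_implyP [Ia npa]] := sI p (mem_head _ _).
exists (x + a * b); first by apply: idealD => //; apply: idealMr.
move=> q; rewrite inE => /predU1P [-> pxab|qs qxab].
  have /pP []// : p (a * b) by rewrite -(addKr x (a * b)) addrC; apply: idealB.
have qid r : r \in s -> ideal r by move=> /sS /sP /prime_idealP [].
apply: (xs q qs); rewrite -(addrK (a * b) x); apply: idealB => //.
  exact: qid.
by apply: idealMl; [apply: qid|apply: mulset_ideal sb].
Qed.

(** * Local rings of dimension one *)

Section LocalRing.
Variable m : set R.
Hypotheses (noeR : noetherian R) (locR : local_ring m).

(** Noetherian induction replaces Zorn's lemma: a proper ideal that is not maximal lies in a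
    strictly larger proper one. *)
Lemma local_ring_proper I : ideal I -> ~ I 1 -> I `<=` m.
Proof.
move: I; apply: noetherian_ind => // I Iid IHI I1.
have [Imax|Inmax] := pselect (maximal_ideal I).
  by rewrite (locR.2 I Imax).
have [J [Jid [IJ JI]]] : exists J, idealr_closed (mem J) /\ I `<=` J /\ J <> I.
  apply: contrapT => noJ; apply: Inmax; split; first by apply/proper_idealP.
  by move=> J Jid IJ; apply: contrapT => JI; apply: noJ; exists J.
have [{}Jid J1] := (proper_idealP J).1 Jid.
apply: subset_trans (IJ) (IHI J Jid _ J1); split=> // JI'.
by apply: JI; apply/seteqP.
Qed.

Lemma local_ring_unit a : ~ m a -> exists b, b * a = 1.
Proof.
move=> ma; apply: contrapT => nounit; apply: ma.
apply: (local_ring_proper (ideal_principal a)).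
  by move=> [b _ ba]; apply: nounit; exists b.
by exists 1; rewrite ?mul1r.
Qed.

Lemma local_ring_ideal : ideal m.
Proof. by have [[/proper_idealP []]] := locR. Qed.

Lemma local_ring_prime : prime_ideal m.
Proof.
have [[/proper_idealP [mid m1] _] _] := locR.
apply/prime_idealP; split=> // a b mab.
have [ma|/local_ring_unit [c ca1]] := pselect (m a); [by left|right].
by rewrite -[b]mul1r -ca1 -mulrA; apply: idealMl.
Qed.

Hypothesis dim1 : krull_dim R 1.

(** Otherwise [q], [p], [m] form a strict chain of length two. *)
Lemma dim1_prime_incomparable p q : prime_ideal p -> prime_ideal q ->
  p <> m -> q `<=` p -> q = p.
Proof.
move=> pP qP pm qp; apply: contrapT => nqp; apply: dim1.2.
have pm' : p `<=` m.
  by have [pid p1 _] := (prime_idealP p).1 pP; apply: local_ring_proper.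
exists (fun i => match i with 0 => q | 1 => p | _ => m end); split.
  by move=> [|[|i]] _ //; apply: local_ring_prime.
by move=> [|[|i]] // _; split=> // pq; [apply: nqp|apply: pm]; apply/seteqP.
Qed.

Lemma dim1_parameter :
  exists2 x, m x & forall a, m a -> exists n b, a ^+ n = b * x.
Proof.
have mid := local_ring_ideal.
have sub_m p : prime_ideal p -> p `<=` m.
  by move=> /prime_idealP [pid p1 _]; apply: local_ring_proper.
have [s s0 sP] := noetherian_prime_product noeR ideal0.
have [|||x mx xs] := @prime_avoidance_incomparable m [seq p <- s | p != m] mid.
- by move=> p; rewrite mem_filter => /andP [_ /sP []].
- move=> p; rewrite mem_filter => /andP [/eqP pm /sP [pP _]] mp.
  by apply: pm; apply/seteqP; split=> //; apply: sub_m.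
- move=> p q; rewrite !mem_filter => /andP [/eqP pm /sP [pP _]].
  by move=> /andP [_ /sP [qP _]]; apply: dim1_prime_incomparable.
exists x => // a ma.
have [u ux uP] := noetherian_prime_product noeR (ideal_principal x).
(* A non-maximal prime over [x] would contain, hence equal, a prime of [s] other than [m], and [x]
   avoids those. *)
have um q : q \in u -> q = m.
  move=> /uP [qP xq]; apply: contrapT => qm.
  have [|p ps pq] := mulset_prime (s := s) qP.
    by move=> b /s0 ->; have /prime_idealP [/idealP []] := qP.
  have [pP _] := sP p ps; have eqpq := dim1_prime_incomparable qP pP qm pq.
  apply: (xs q); last by apply: xq; exists 1; rewrite ?mul1r.
  by rewrite mem_filter -{2}eqpq ps andbT; apply/eqP.
(* Every factor of the product is [m] and so contains [a]; hence some power of [a] is in the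
   product. *)
have [_ [/ux [b _ <-] [n _ abx]]] : mulset u `&` range (GRing.exp a) !=set0.
  apply: mulset_exists.
  - by move=> q /um ->; exists a; split=> //; exists 1.
  - by move=> _ _ [i _ <-] [j _ <-]; exists (i + j)%N; rewrite // exprD.
  - by exists 0%N.
by exists n, b.
Qed.

Lemma buchsbaum_annihilator : buchsbaum m ->
  exists2 x, m x & forall n c, c * x ^+ n = 0 -> forall b, m b -> c * b = 0.
Proof.
move=> bR; have [x mx xP] := dim1_parameter; exists x => // -[|n] c.
  by rewrite expr0 mulr1 => -> b _; rewrite mul0r.
move=> cx0 b mb; pose y (i : 'I_1) := x ^+ n.+1.
have mid := local_ring_ideal.
have sop : system_of_parameters m y.
  split=> //; apply/seteqP; split=> [a [k yak]|a /xP [k [d adx]]].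
    apply: (prime_idealX (n := k) local_ring_prime).
    apply: (smallest_sub (C := @ideal R)) yak => // _ [i _ <-].
    by rewrite /y exprSr; apply: idealMl.
  (* Raising [a ^+ k = d * x] to the power [n.+1] produces a multiple of [x ^+ n.+1]. *)
  exists (k * n.+1)%N; rewrite exprM adx exprMn.
  apply: (@idealMl (ideal_gen _)).
    exact: submodule_span.
  by apply: sub_gen_smallest; exists ord0.
have /= := bR 1%N y sop ord0; set I := ideal_gen _ => colonI.
(* No index is below [ord0], so [I] has no generators. *)
have I0 : I `<=` [set 0].
  by apply: (smallest_sub (C := @ideal R)) => [|_ [j //]]; apply: ideal0.
have : colon I [set y ord0] c.
  move=> _ ->; rewrite cx0.
  by have /idealP [] : ideal I by exact: submodule_span.
by rewrite colonI => /(_ b mb) /I0.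
Qed.

(** If no power of [x] kills [v], the cyclic modules R x^j v strictly decrease: x^j v = a x^(j+1) v
    gives (1 - a x) x^j v = 0, and 1 - a x is a unit. *)
Lemma finite_length_torsion V (N : set V) x v :
  submodule N -> finite_length N -> m x -> N v -> exists n, x ^+ n *: v = 0.
Proof.
move=> Nsub [l [_ nochain]] mx Nv; apply: contrapT => xv.
(* The exponents run from [l.+1] down to 0, which gives an increasing chain of length [l.+1]. *)
apply: nochain; exists (fun i => [set a *: (x ^+ (l.+1 - i) *: v) | a in setT]).
split=> i li; first split; first exact: submodule_cyclic.
  by move=> _ [a _ <-]; rewrite scalerA; apply: submoduleZ.
rewrite subSS subSn //; split=> [_ [a _ <-]|xv_sub].
  by exists (a * x); rewrite // exprS -!scalerA.
have [|a _] := xv_sub (x ^+ (l - i) *: v); first by exists 1; rewrite ?scale1r.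
move=> axv; apply: xv; exists (l - i)%N.
have [|b bax] := @local_ring_unit (1 - a * x).
  move=> max1; have [[/proper_idealP [mid m1] _] _] := locR; apply: m1.
  by rewrite -(subrK (a * x) 1); apply: idealD => //; apply: idealMl.
rewrite -[LHS]scale1r -bax -scalerA scalerBl scale1r -{1}axv exprS.
by rewrite !scalerA mulrA subrr scaler0.
Qed.

End LocalRing.

(** * Annihilators and free modules *)

Lemma ideal_smul_annihilated I V a (v : V) :
  (forall b, I b -> a * b = 0) -> ideal_smul I V v -> a *: v = 0.
Proof.
move=> aI; apply: (smallest_sub (X := [set v | a *: v = 0])).
  apply/submoduleP; split=> [|b u w /= au aw]; first exact: scaler0.
  by rewrite scalerDr scalerA mulrC -scalerA au aw scaler0 addr0.
by move=> _ [b Ib [w ->]]; rewrite /= scalerA aI // scale0r.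
Qed.

(** With [c] the coordinates of [v], both [0] and [a *: c] are coordinates of the zero vector, so
    they agree. *)
Lemma fg_free_annihilated V a (v : V) : fg_free V -> a *: v = 0 ->
  exists n (e : 'I_n -> V) (c : 'I_n -> R),
    v = \sum_i c i *: e i /\ forall i, c i * a = 0.
Proof.
move=> [n [e eP]] av0; have [c [vE _]] := eP v.
exists n, e, (c ord0); split=> // i.
have [d [_ d_uniq]] := eP 0.
have d0 : d = 0.
  by apply: d_uniq; rewrite big1 // => j _; rewrite mxE scale0r.
have dac : d = a *: c.
  apply: d_uniq; rewrite -[LHS]av0 vE scaler_sumr /=; apply: eq_bigr => j _.
  by rewrite mxE scalerA.
have := congr1 (fun c : 'rV_n => c ord0 i) dac.
by rewrite d0 !mxE mulrC.
Qed.

(** Either the rank is zero or there is a first basis vector, which no nonzero scalar kills. *)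
Lemma fg_free_faithful V : fg_free V ->
  (forall v : V, v = 0) \/ exists v : V, forall a, a *: v = 0 -> a = 0.
Proof.
move=> [[|n] [e eP]].
  by left=> v; have [c [-> _]] := eP v; rewrite big_ord0.
right; exists (e ord0) => a ae0; have [d [_ d_uniq]] := eP 0.
have d0 : d = 0.
  by apply: d_uniq; rewrite big1 // => j _; rewrite mxE scale0r.
have dE : d = a *: delta_mx 0 0.
  apply: d_uniq; rewrite (bigD1 ord0) //= big1 ?addr0 => [|j j0].
    by rewrite !mxE !eqxx mulr1.
  by rewrite !mxE (negPf j0) andbF mulr0 scale0r.
have := congr1 (fun c : 'rV_n.+1 => c ord0 ord0) dE.
by rewrite d0 !mxE !eqxx mulr1.
Qed.

Lemma fg_free_projective V : fg_free V -> projective V.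
Proof.
move=> [n [e eP]] A B f g fsurj.
have lift i : exists x, f x = g (e i).
  have [x _ fx] : range f (g (e i)) by rewrite fsurj.
  by exists x.
have [a aP] := choice lift.
have [co coP] := choice eP.
(* Coordinates depend linearly on the vector because they are unique. *)
have co_lin k u v : co (k *: u + v) = k *: co u + co v.
  apply: (coP _).2; rewrite {1}(coP u).1 {1}(coP v).1 scaler_sumr -big_split /=.
  by apply: eq_bigr => i _; rewrite !mxE scalerDl scalerA.
pose h v := \sum_i co v ord0 i *: a i.
have h_lin : linear h.
  move=> k u v; rewrite /h co_lin scaler_sumr -big_split /=.
  by apply: eq_bigr => i _; rewrite !mxE scalerDl scalerA.
pose hL := GRing.isLinear.Build R V A _ h h_lin.
pose H : {linear V -> A} := HB.pack h hL.
exists H => v; rewrite /= /h {2}(coP v).1 !linear_sum; apply: eq_bigr => i _.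
by rewrite !linearZ /= aP.
Qed.

(** * Truncation of a resolution *)

Definition truncated_module (b : bool) (V : lmodType R) : lmodType R :=
  if b then V else 'rV[R]_0.

(** The flags let one formula describe all degrees, kept or replaced by zero, without casts. *)
Definition truncated_map (b b' : bool) (V W : lmodType R)
    (f : {linear V -> W}) :
    {linear truncated_module b V -> truncated_module b' W} :=
  match b, b' return
    {linear truncated_module b V -> truncated_module b' W} with
  | true, true => f
  | _, _ => \0
  end.

(** The implications say that the cut removes everything above some degree. Exactness is at risk
    only at the last kept term, and the injectivity of [g] restores it there. *)
Lemma truncated_exact (b1 b2 b3 : bool) (U V W : lmodType R)
    (f : {linear U -> V}) (g : {linear V -> W}) :
  (b1 -> b2) -> (b2 -> b3) -> range f = [set x | g x = 0] ->
  (b2 -> ~~ b1 -> forall x, g x = 0 -> x = 0) ->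
  range (truncated_map b1 b2 f) = [set x | truncated_map b2 b3 g x = 0].
Proof.
case: b2 => [_ b23|_ _ _ _]; last first.
  apply/seteqP; split=> x _; first by case: b3.
  by exists 0; rewrite // [RHS]thinmx0 [LHS]thinmx0.
rewrite {}b23 //; case: b1 => [//|_ /(_ isT isT) g_inj] /=.
apply/seteqP; split=> [_ [x _ <-]|x /g_inj ->]; first exact: linear0.
by exists 0.
Qed.

Lemma truncated_projective b V :
  projective V -> projective (truncated_module b V).
Proof.
by case: b => // _ A B f g _; exists \0 => x; rewrite [x]thinmx0 !linear0.
Qed.

Section Resolution.
Variables (M : lmodType R) (G : resolution M).

Lemma projdim_le_injective n : (forall j, projective (term G j)) ->
  (forall x, diff G n x = 0 -> x = 0) -> projdim_le M n.+1.
Proof.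
move=> Gproj inj.
unshelve eexists (@Resolution R M
  (fun j => truncated_module (j <= n.+1)%N (term G j))
  (fun j => truncated_map _ _ (diff G j)) (aug G) _ _ _).
- exact: aug_surj.
- exact: aug_exact.
- move=> j.
  refine (@truncated_exact (j.+1 < n.+1)%N (j < n.+1)%N (j <= n.+1)%N _ _ _
    (diff G j.+1) (diff G j) _ _ (diff_exact G j) _);
    [exact: ltnW|exact: ltnW|].
  (* The last kept term is [term G n.+1], whose outgoing map is [diff G n]. *)
  move=> jn nj; have eq_jn : j = n.
    by apply/eqP; rewrite eqn_leq -(ltnS j) jn leqNgt.
  by move: inj; rewrite -eq_jn.
split=> j /=; first exact: truncated_projective.
by rewrite ltnNge => /negbTE -> x; rewrite [x]thinmx0.
Qed.

End Resolution.

End Submodules.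

(** * Syzygies of infinite length *)

Theorem proposition5p3 (R : comNzRingType) (m : set R) (M : lmodType R)
    (G : resolution M) :
  noetherian R -> local_ring m -> krull_dim R 1 -> buchsbaum m ->
  finitely_generated (@setT M) -> finite_length (@setT M) ->
  infinite_projdim M ->
  minimal_free_resolution m G ->
  forall i : nat, (2 < i)%N -> ~ finite_length (syzygy G i).
Proof.
(* With [i = k.+3] the syzygy lies in [term G k.+2], which leaves the two maps [diff G k.+1] and
   [diff G k] below it. *)
move=> noeR locR dim1 bR _ _ pdM [Gfree Gmin] [|[|[|k]]] // _ /= finN.
have inj_absurd p : (forall x, diff G p x = 0 -> x = 0) -> False.
  move=> inj; apply: pdM; exists p.+1; apply: projdim_le_injective inj => j.
  exact: fg_free_projective.
have [x mx annx] := buchsbaum_annihilator noeR locR dim1 bR.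
have torsion n j (w : term G j) :
    x ^+ n *: w = 0 -> forall b, m b -> b *: w = 0.
  move=> /(fg_free_annihilated (Gfree j)) [r [e [c [-> cx]]]] b mb.
  rewrite scaler_sumr big1 // => i _.
  by rewrite scalerA mulrC (annx n _ (cx i)) // scale0r.
have diff_torsion n j (w : term G j.+1) : x ^+ n *: w = 0 -> diff G j w = 0.
  move=> /(fg_free_annihilated (Gfree j.+1)) [r [e [c [-> cx]]]].
  rewrite linear_sum big1 // => i _; rewrite linearZ /=.
  apply: (ideal_smul_annihilated (I := m)) (annx n _ (cx i)) _.
  by apply: Gmin; exists (e i).
have kerx (w : term G k.+2) : diff G k.+1 w = 0 -> exists n, x ^+ n *: w = 0.
  move=> dw0; apply: (finite_length_torsion noeR locR _ finN mx).
    rewrite diff_exact; apply/submoduleP; split=> [|a u v /= du dv].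
      exact: linear0.
    by rewrite linearP du dv scaler0 addr0.
  by rewrite diff_exact.
apply: (inj_absurd k.+1) => w0 dw0.
apply: contrapT => w0_neq0.
(* The nonzero kernel element [w0] has a nonzero coordinate, which serves as [u]. *)
have [u [um u_neq0]] : exists u, (forall b, m b -> u * b = 0) /\ u <> 0.
  apply: contrapT => nou; apply: w0_neq0; have [n xw0] := kerx w0 dw0.
  have [r [e [c [-> cx]]]] := fg_free_annihilated (Gfree _) xw0.
  rewrite big1 // => i _; have -> : c i = 0; last by rewrite scale0r.
  apply: contrapT => ci; apply: nou; exists (c i); split=> //.
  exact: annx (cx i).
(* If [term G k.+1] is zero, [diff G k] is trivially injective; otherwise the contradiction to reach
   is [u *: e0 = 0]. *)
have [term0|[e0 e0P]] := fg_free_faithful (Gfree k.+1).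
  by apply: (inj_absurd k) => v _; apply: term0.
apply/u_neq0/e0P.
have [w _ dw] : range (diff G k.+1) (u *: e0).
  rewrite diff_exact /= linearZ /=; apply: (ideal_smul_annihilated um).
  by apply: Gmin; exists e0.
have dxw : diff G k.+1 (x *: w) = 0.
  by rewrite linearZ /= dw scalerA mulrC um // scale0r.
have [n xnw] := kerx _ dxw.
(* Since [x ^+ n] kills [x *: w], the power [x ^+ n.+1] kills [w]. *)
rewrite -dw; apply: (diff_torsion n.+1).
by rewrite exprSr -scalerA.
Qed.
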